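(* The category $\mathbf{OWF}$ of all open well-filtered spaces with continuous mappings is not reflective in the category $\mathbf{Top_0}$ of all $T_0$ spaces with continuous mappings.
   Context: Let $X$ be a $T_0$ space and $\mathcal{O}(X)$ its lattice of open sets ordered by inclusion. For $U,V\in\mathcal{O}(X)$, $U\ll V$ (way-below in $(\mathcal{O}(X),\subseteq)$) means that every directed family of open sets whose union contains $V$ has a member containing $U$. A nonempty family $\mathcal{F}\subseteq\mathcal{O}(X)$ is $\ll$-filtered if for any $U_1,U_2\in\mathcal{F}$ there exists $U_3\in\mathcal{F}$ such that $U_3\ll U_1$ and $U_3\ll U_2$. $X$ is open well-filtered if for each $\ll$-filtered family $\mathcal{F}\subseteq\mathcal{O}(X)$ and each $U\in\mathcal{O}(X)$, $\bigcap\mathcal{F}\subseteq U$ implies $V\subseteq U$ for some $V\in\mathcal{F}$. A full subcategory $\mathbf{K}$ of $\mathbf{Top_0}$ is reflective if for each $X\in\mathbf{Top_0}$ there are $X^k\in\mathbf{K}$ and a continuous mapping $\mu_X:X\to X^k$ such that for every continuous mapping $f:X\to Z$ with $Z\in\mathbf{K}$ there is a unique continuous mapping $g:X^k\to Z$ with $g\circ\mu_X=f$. *)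

(* Defs.v *)
From mathcomp Require Import all_boot all_order.
From mathcomp Require Import all_classical topology.

Set Implicit Arguments.
Unset Strict Implicit.
Unset Printing Implicit Defensive.

Local Open Scope classical_set_scope.

(* Directed families are nonempty, as usual in order theory; without this the
   empty family would prevent set0 from being way below itself. *)
Definition directed_family (T : Type) (D : set (set T)) : Prop :=
  D !=set0 /\
  forall A B, D A -> D B -> exists C, [/\ D C, A `<=` C & B `<=` C].

(* The way-below relation of the lattice of open sets of X, meant for open
   U and V; suprema of open sets are unions. *)
Definition way_below (X : topologicalType) (U V : set X) : Prop :=
  forall D : set (set X), D `<=` open -> directed_family D ->
    V `<=` \bigcup_(W in D) W -> exists2 W, D W & U `<=` W.

Definition way_below_filtered (X : topologicalType) (F : set (set X)) : Prop :=
  [/\ F !=set0, F `<=` open &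
      forall U1 U2, F U1 -> F U2 ->
        exists U3, [/\ F U3, way_below U3 U1 & way_below U3 U2]].

Definition open_well_filtered (X : topologicalType) : Prop :=
  forall F : set (set X), way_below_filtered F ->
  forall U : set X, open U -> \bigcap_(V in F) V `<=` U ->
    exists2 V, F V & V `<=` U.

(* A full subcategory is given by its class of objects. *)
Definition OWF (X : topologicalType) : Prop :=
  kolmogorov_space X /\ open_well_filtered X.

(* K is meant to consist of T0 spaces. *)
Definition reflective_in_Top0 (K : topologicalType -> Prop) : Prop :=
  forall X : topologicalType, kolmogorov_space X ->
  exists Xk : topologicalType, K Xk /\
  exists mu : X -> Xk, continuous mu /\
  forall Z : topologicalType, K Z ->
  forall f : X -> Z, continuous f ->
  exists! g : Xk -> Z, continuous g /\ g \o mu = f.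

(* Main.v *)
From HB Require Import structures.
From mathcomp Require Import all_boot all_order.
From mathcomp Require Import all_classical topology.
Require Import Defs.

Set Implicit Arguments.
Unset Strict Implicit.
Unset Printing Implicit Defensive.

Local Open Scope classical_set_scope.

(* A reflective full subcategory is closed under retracts, up to homeomorphism,
   so it suffices to exhibit a space that is not open well-filtered but is a
   retract of one that is.  A space in which only the empty set is way below
   the whole space is open well-filtered, and if Y is Baire space,
   then X * Y has this property for every X.  Since X is a retract of X * Y,
   any T0 space X that is not open well-filtered will do, for instance the
   natural numbers with the topology of upper sets. *)

(** The reflection arrow [h] of [X] is itself the homeomorphism: factoring [i] as [g \o h] makes
    [p \o g] a left inverse of [h], and uniqueness of factorizations makes it a right inverse. *)
Lemma reflective_retract (K : topologicalType -> Prop) (X Y : topologicalType)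
    (i : X -> Y) (p : Y -> X) :
  reflective_in_Top0 K -> kolmogorov_space X -> K Y ->
  continuous i -> continuous p -> cancel i p ->
  exists (Z : topologicalType) (h : X -> Z) (k : Z -> X),
    [/\ K Z, continuous h, continuous k, cancel h k & cancel k h].
Proof.
move=> refl X0 KY ci cp ipK; have [Z [KZ [h [ch hU]]]] := refl X X0.
have [g [[cg gh] _]] := hU Y KY i ci.
have cgp : continuous (p \o g).
  by move=> z; apply: continuous_comp; [exact: cg|exact: cp].
have pghK : cancel h (p \o g).
  by move=> x /=; rewrite -[g _]/((g \o h) x) gh ipK.
exists Z, h, (p \o g); split => // z.
(* The arrow [h] is factored through itself: both [h \o (p \o g)] and the identity do this, so they
   coincide. *)
have [e [_ eU]] := hU Z KZ h ch.
have eh : e = h \o (p \o g).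
  apply: eU; split.
    by move=> t; apply: continuous_comp; [exact: cgp|exact: ch].
  by apply/funext => x; rewrite [LHS]/= -/((p \o g) (h x)) pghK.
have e_id : e = id by apply: eU; split => // t; exact: cvg_id.
by rewrite -[LHS]/((h \o (p \o g)) z) -eh e_id.
Qed.

Section homeomorphism.
Variables (X Z : topologicalType) (h : X -> Z) (k : Z -> X).
Hypotheses (ch : continuous h) (ck : continuous k).
Hypotheses (hK : cancel h k) (kK : cancel k h).

Lemma way_below_preimage (U V : set X) :
  way_below U V -> way_below (k @^-1` U) (k @^-1` V).
Proof.
move=> UV D Dop [[A0 DA0] Ddir] VD.
have [_ [A DA <-] UA] : exists2 W, [set h @^-1` A | A in D] W & U `<=` W.
  apply: UV.
  - by move=> _ [A DA <-]; apply: open_comp => [z _|]; [exact: ch|exact: Dop].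
  - split; first by exists (h @^-1` A0), A0.
    move=> _ _ [A DA <-] [B DB <-]; have [C [DC AC BC]] := Ddir _ _ DA DB.
    by exists (h @^-1` C); split; [exists C|move=> x /AC|move=> x /BC].
  - move=> x Vx; have [|A DA Ahx] := VD (h x); first by rewrite /= hK.
    by exists (h @^-1` A) => //; exists A.
by exists A => // z /UA; rewrite /= kK.
Qed.

Lemma open_well_filtered_homeo : open_well_filtered Z -> open_well_filtered X.
Proof.
move=> Zowf F [[A0 FA0] Fop Ffil] U Uop FU.
have opk (A : set X) : open A -> open (k @^-1` A).
  by apply: open_comp => z _; exact: ck.
have [_ [A FA <-] AU] :
    exists2 W, [set k @^-1` A | A in F] W & W `<=` k @^-1` U.
  apply: Zowf; last 2 first.
  - exact: opk.
  - move=> z Fz; by apply: FU => A FA; apply: (Fz (k @^-1` A)); exists A.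
  split; first by exists (k @^-1` A0), A0.
    by move=> _ [A /Fop/opk Aop <-].
  move=> _ _ [A FA <-] [B FB <-]; have [C [FC CA CB]] := Ffil _ _ FA FB.
  by exists (k @^-1` C); split; [exists C|exact: way_below_preimage..].
by exists A => // x Ax; rewrite -(hK x); apply: AU; rewrite /= hK.
Qed.

End homeomorphism.

Lemma continuous_pair_left (X Y : topologicalType) (y : Y) :
  continuous (fun x : X => (x, y)).
Proof. by move=> x; apply: cvg_pair; [exact: cvg_id|exact: cvg_cst]. Qed.

Lemma continuous_pair_right (X Y : topologicalType) (x : X) :
  continuous (fun y : Y => (x, y)).
Proof. by move=> y; apply: cvg_pair; [exact: cvg_cst|exact: cvg_id]. Qed.

Definition way_below_trivial (X : topologicalType) :=
  forall U : set X, open U -> way_below U setT -> U = set0.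

(** Filteredness applied to one member [A] taken twice gives a member way below [A], hence way below
    the whole space, hence empty; it lies in every [U]. *)
Lemma way_below_trivial_open_well_filtered (X : topologicalType) :
  way_below_trivial X -> open_well_filtered X.
Proof.
move=> Xtriv F [[A FA] Fop Ffil] U _ _; have [B [FB BA _]] := Ffil _ _ FA FA.
exists B => //; suff -> : B = set0 by exact: sub0set.
apply: Xtriv; first exact: Fop.
(* Enlarging the right-hand side preserves [way_below]: a cover of the whole space also covers
   [A]. *)
by move=> D Dop Ddir DT; apply: BA => // x _; exact: DT.
Qed.

(** A directed open cover of [Y] pulls back along [snd] to one of the product, so each slice of [U]
    over a point of [X] is way below the whole of [Y], hence empty. *)
Lemma way_below_trivial_prod (X Y : topologicalType) :
  way_below_trivial Y -> way_below_trivial (X * Y)%type.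
Proof.
move=> Ytriv U Uop UT; apply/seteqP; split => // -[x y] Uxy.
have : (fun y' => (x, y')) @^-1` U = set0; last by move/seteqP => [/(_ y Uxy)].
apply: Ytriv.
  by apply: open_comp Uop => y' _; exact: continuous_pair_right.
move=> D Dop [[A0 DA0] Ddir] DT.
have [_ [A DA <-] UA] :
    exists2 W, [set (@snd X Y) @^-1` A | A in D] W & U `<=` W.
  apply: UT.
  - by move=> _ [A /Dop Aop <-]; apply: open_comp Aop => z _; exact: cvg_snd.
  - split; first by exists (snd @^-1` A0), A0.
    move=> _ _ [A DA <-] [B DB <-]; have [C [DC AC BC]] := Ddir _ _ DA DB.
    by exists (snd @^-1` C); split; [exists C|move=> z /AC|move=> z /BC].
  - move=> z _; have [A DA Az] := DT z.2 I.
    by exists (snd @^-1` A) => //; exists A.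
by exists A => // y' /UA.
Qed.

Lemma kolmogorov_space_prod (X Y : topologicalType) :
  kolmogorov_space X -> kolmogorov_space Y -> kolmogorov_space (X * Y)%type.
Proof.
move=> X0 Y0 [x1 y1] [x2 y2]; have [->|/X0[A HA] _] := eqVneq x1 x2.
  have [->|/Y0[B HB] _] := eqVneq y1 y2; first by rewrite eqxx.
  exists (snd @^-1` B); rewrite !inE/= in HB *.
  by case: HB => -[nB yB]; [left|right]; split=> //; apply: cvg_snd.
exists (fst @^-1` A); rewrite !inE/= in HA *.
by case: HA => -[nA xA]; [left|right]; split=> //; apply: cvg_fst.
Qed.

Lemma open_kolmogorov_space (X : topologicalType) :
  (forall x y : X, x != y ->
    exists U, open U /\ (U x /\ ~ U y \/ U y /\ ~ U x)) ->
  kolmogorov_space X.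
Proof.
move=> sep x y /sep[U [Uop xyU]]; exists U; rewrite !inE.
by case: xyU => -[? ?]; [left|right]; split=> //; exact: open_nbhs_nbhs.
Qed.

Definition upper_nat : Type := nat.

HB.instance Definition _ := Choice.on upper_nat.

Definition upper_nat_open (U : set upper_nat) :=
  forall m n : nat, m <= n -> U m -> U n.

Lemma upper_nat_openT : upper_nat_open setT.
Proof. by []. Qed.

Lemma upper_nat_openI : setI_closed upper_nat_open.
Proof. by move=> A B Aup Bup m n mn [/(Aup _ _ mn) ? /(Bup _ _ mn)]. Qed.

Lemma upper_nat_open_bigU (I : Type) (f : I -> set upper_nat) :
  (forall i, upper_nat_open (f i)) -> upper_nat_open (\bigcup_i f i).
Proof. by move=> fup m n mn [i _ /(fup _ _ _ mn)]; exists i. Qed.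

HB.instance Definition _ := isOpenTopological.Build upper_nat
  upper_nat_openT upper_nat_openI upper_nat_open_bigU.

Lemma upper_natE (U : set upper_nat) : open U = upper_nat_open U.
Proof. by []. Qed.

Definition up_from (n : nat) : set upper_nat := [set m : nat | n <= m].

Lemma open_up_from n : open (up_from n).
Proof. by rewrite upper_natE => m p mp nm; exact: leq_trans mp. Qed.

Lemma upper_nat_kolmogorov : kolmogorov_space upper_nat.
Proof.
apply: open_kolmogorov_space => m n mn.
have [lemn|ltnm] := leqP (m : nat) n.
  exists (up_from n); split; first exact: open_up_from.
  by right; split; rewrite /up_from /= ?leqnn// => lenm; case/negP: mn;
    apply/eqP/anti_leq/andP.
exists (up_from m); split; first exact: open_up_from.
by left; split; rewrite /up_from /= ?leqnn//; apply/negP; rewrite -ltnNge.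
Qed.

(** The least open set containing [n] is [up_from n], so whichever member of [D] contains [n]
    contains all of it. *)
Lemma way_below_up_from n (V : set upper_nat) : V n -> way_below (up_from n) V.
Proof.
move=> Vn D Dop _ DV; have [A DA An] := DV _ Vn.
by exists A => // m nm; apply: (Dop _ DA) An.
Qed.

(** The sets [up_from n] form a filtered family with empty intersection, yet none of them is
    empty. *)
Lemma upper_nat_not_open_well_filtered : ~ open_well_filtered upper_nat.
Proof.
move=> /(_ (range up_from)) owf.
have [|||_ [n _ <-] /(_ n)] := owf _ set0.
- split; first by exists (up_from 0), 0.
    by move=> _ [n _ <-]; exact: open_up_from.
  (* The point [maxn m n] lies in both given sets, so its principal upper set is way below each. *)
  move=> _ _ [m _ <-] [n _ <-]; exists (up_from (maxn m n)); split.
  + exact: imageP.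
  + by apply: way_below_up_from; exact: leq_maxl.
  + by apply: way_below_up_from; exact: leq_maxr.
- exact: open0.
- move=> n Fn; have : up_from n.+1 n by apply: Fn; exists n.+1.
  by rewrite /up_from /= ltnn.
- by apply; exact: leqnn.
Qed.

Definition baire : Type := nat -> nat.

HB.instance Definition _ := gen_eqMixin baire.
HB.instance Definition _ := gen_choiceMixin baire.

(** The product topology of countably many discrete copies of [nat]: the cylinders fixing an initial
    segment of [x] form a neighbourhood base at [x]. *)
Definition baire_open (U : set baire) :=
  forall x, U x -> exists n, forall y : baire,
    (forall i, i < n -> y i = x i) -> U y.

Lemma baire_openT : baire_open setT.
Proof. by exists 0. Qed.

Lemma baire_openI : setI_closed baire_open.
Proof.
move=> A B Aop Bop x [/Aop[m mA] /Bop[n nB]]; exists (maxn m n) => y yx.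
by split; [apply: mA|apply: nB] => i im; apply: yx; rewrite leq_max im ?orbT.
Qed.

Lemma baire_open_bigU (I : Type) (f : I -> set baire) :
  (forall i, baire_open (f i)) -> baire_open (\bigcup_i f i).
Proof. by move=> fop x [i _ /fop[n nf]]; exists n => y /nf; exists i. Qed.

HB.instance Definition _ := isOpenTopological.Build baire
  baire_openT baire_openI baire_open_bigU.

Lemma baireE (U : set baire) : open U = baire_open U.
Proof. by []. Qed.

Lemma open_baire_coord n (P : set nat) : open [set x : baire | P (x n)].
Proof. by rewrite baireE => x Px; exists n.+1 => y /(_ n)/= ->. Qed.

Lemma baire_kolmogorov : kolmogorov_space baire.
Proof.
apply: open_kolmogorov_space => x y /eqP xy.
have [i xyi] : exists i, x i <> y i.
  by apply/existsNP => xyE; apply: xy; exact/funext.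
exists [set z : baire | z i = x i]; split.
  exact: (@open_baire_coord i [set x i]).
by left; split=> //= /esym.
Qed.

(* A nonempty open set contains a cylinder, on which the first free coordinate
   is unbounded; the sets bounding that coordinate are a directed open cover. *)
Lemma baire_way_below_trivial : way_below_trivial baire.
Proof.
move=> U Uop UT; apply/seteqP; split => // x Ux; have [n nU] := Uop x Ux.
have [|||_ [k _ <-] /(_ (fun i => if i < n then x i else k.+1))] :=
    UT (range (fun k => [set y : baire | y n <= k])).
- by move=> _ [k _ <-]; exact: (@open_baire_coord n [set m | m <= k]).
- split; first by exists [set y : baire | y n <= 0], 0.
  move=> _ _ [k _ <-] [l _ <-]; exists [set y : baire | y n <= maxn k l].
  split; first by exists (maxn k l).
    by move=> y /= yk; rewrite leq_max yk.
  by move=> y /= yl; rewrite leq_max yl orbT.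
- by move=> y _; exists [set z : baire | z n <= y n] => /=; [exists (y n)|].
(* The chosen point agrees with [x] below [n], so it lies in [U], but its coordinate [n] is [k.+1],
   just past the bound [k]. *)
- by rewrite /= !ltnn => Uk; suff : false by []; apply: Uk; apply: nU => i ->.
Qed.

Theorem corollary3p12 : ~ reflective_in_Top0 OWF.
Proof.
move=> refl; apply: upper_nat_not_open_well_filtered.
(* A section of [fst]; the zero sequence is an arbitrary choice of base point in [baire]. *)
pose i (n : upper_nat) : upper_nat * baire := (n, fun=> 0).
have [||||Z [h [k [[_ Zowf] ch ck hK kK]]]] :=
    @reflective_retract OWF _ _ i fst refl upper_nat_kolmogorov.
- split.
    exact: kolmogorov_space_prod upper_nat_kolmogorov baire_kolmogorov.
  apply: way_below_trivial_open_well_filtered.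
  exact: way_below_trivial_prod baire_way_below_trivial.
- exact: (@continuous_pair_left upper_nat baire).
- by move=> z; exact: cvg_fst.
- by [].
exact: open_well_filtered_homeo ch ck hK kK Zowf.
Qed.
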